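(* Let $p>0$. There does not exist a nontrivial (i.e. not identically zero) continuous linear functional on the space $(L_p,\|\cdot\|_p)$.
   Context: For $p>0$, $L_p=L^+_p(dt/2\pi)$ is the complex vector space of all (a.e.-equivalence classes of) complex-valued Lebesgue measurable functions $f$ on $[0,2\pi)$ with $$(\|f\|_p)^p:=\int_0^{2\pi}(\log(1+|f(t)|))^p\,\frac{dt}{2\pi}<\infty.$$ The topology of $(L_p,\|\cdot\|_p)$ is that of the metric $\rho_p(f,g)=(\|f-g\|_p)^{\min\{p,1\}}$. *)

(* Defs.v *)
From HB Require Import structures.
From mathcomp Require Import all_boot all_order all_algebra complex.
From mathcomp Require Import all_classical all_reals all_analysis measurable_realfun.

Set Implicit Arguments.
Unset Strict Implicit.
Unset Printing Implicit Defensive.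

Import Order.TTheory GRing.Theory Num.Theory.
Import Normc numFieldNormedType.Exports.

Local Open Scope classical_set_scope.
Local Open Scope ring_scope.
Local Open Scope quotient_scope.

(* In this file a function on D is a total function on T of which only the
   values on D are constrained or observed. *)
Definition complex_measurable_fun d (T : measurableType d) (R : realType)
    (D : set T) (f : T -> R[i]) :=
  measurable_fun D (fun t => complex.Re (f t)) /\
  measurable_fun D (fun t => complex.Im (f t)).

Definition log1pabs (T : Type) (R : realType) (f : T -> R[i]) (t : T) : R :=
  ln (1 + normc (f t)).

(* Locked because unification otherwise unfolds the integral when it compares
   the log_integral of two different functions. *)
HB.lock Definition log_integral d (T : measurableType d) (R : realType)
    (mu : {measure set T -> \bar R}) (D : set T) (p : R) (f : T -> R[i]) :
    \bar R :=
  (\int[mu]_(t in D) (log1pabs f t `^ p)%:E)%E.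
Canonical log_integral_unlockable := Unlockable log_integral.unlock.

Definition Lpfun d (T : measurableType d) (R : realType)
    (mu : {measure set T -> \bar R}) (D : set T) (p : R) : {pred T -> R[i]} :=
  mem [set f | complex_measurable_fun D f /\ (log_integral mu D p f < +oo)%E].

(* The quantity ||f||_p determined by (||f||_p)^p = log_integral mu D p f. *)
Definition lognorm d (T : measurableType d) (R : realType)
    (mu : {measure set T -> \bar R}) (D : set T) (p : R) (f : T -> R[i]) : R :=
  fine (log_integral mu D p f) `^ p^-1.

Section log_integral_lemmas.
Context d (T : measurableType d) (R : realType).
Variables (mu : {measure set T -> \bar R}) (D : set T) (mD : measurable D).
Implicit Types (f g : T -> R[i]) (a b : R).

Let normc_ge0 (z : R[i]) : 0 <= normc z.
Proof. by case: z => a b; exact: sqrtr_ge0. Qed.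

Lemma log1pabs_ge0 f t : 0 <= log1pabs f t.
Proof. by rewrite ln_ge0// lerDl. Qed.

Lemma ler_log1pabs f g t :
  normc (f t) <= normc (g t) -> log1pabs f t <= log1pabs g t.
Proof. by move=> fg; rewrite ler_ln ?posrE ?ltr_pwDl// lerD2l. Qed.

Lemma log1pabsD f g t : log1pabs (f + g) t <= log1pabs f t + log1pabs g t.
Proof.
rewrite /log1pabs -lnM ?posrE ?ltr_pwDl//.
rewrite ler_ln ?posrE ?mulr_gt0 ?ltr_pwDl//.
rewrite mulrDl mul1r mulrDr mulr1 -addrA lerD2l.
rewrite (le_trans (le_normcD _ _))// [leRHS]addrCA addrA lerDl.
exact: mulr_ge0.
Qed.

Lemma log1pabsN f t : log1pabs (- f) t = log1pabs f t.
Proof. by rewrite /log1pabs normcN. Qed.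

Lemma log1pabs_eq0 f t : log1pabs f t = 0 -> f t = 0.
Proof.
move=> /eqP; rewrite ln_eq0 ?ltr_pwDl// -subr_eq0 addrAC subrr add0r.
by move=> /eqP /eq0_normc.
Qed.

Lemma measurable_log1pabs f :
  complex_measurable_fun D f -> measurable_fun D (log1pabs f).
Proof.
move=> [mr mi].
apply: (@measurableT_comp _ _ _ _ _ _ (@ln R)) => //.
apply: measurable_funD => //.
rewrite (_ : (fun t => normc (f t)) =
  (fun t => Num.sqrt (complex.Re (f t) ^+ 2 + complex.Im (f t) ^+ 2))); last first.
  by apply/funext => t /=; case: (f t).
apply: (@measurableT_comp _ _ _ _ _ _ (@Num.sqrt R)) => //.
  apply: continuous_measurable_fun; exact: sqrt_continuous.
by apply: measurable_funD; exact: measurable_funX.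
Qed.


Lemma complex_measurable_funD f g : complex_measurable_fun D f ->
  complex_measurable_fun D g -> complex_measurable_fun D (f + g).
Proof.
move=> [fr fi] [gr gi]; split.
- rewrite (_ : (fun t => _) = (fun t => complex.Re (f t) + complex.Re (g t))).
    exact: measurable_funD.
  by apply/funext => t; rewrite /= fctE; case: (f t); case: (g t).
- rewrite (_ : (fun t => _) = (fun t => complex.Im (f t) + complex.Im (g t))).
    exact: measurable_funD.
  by apply/funext => t; rewrite /= fctE; case: (f t); case: (g t).
Qed.

Lemma complex_measurable_funZ (c : R[i]) f : complex_measurable_fun D f ->
  complex_measurable_fun D (c *: f).
Proof.
move=> [fr fi]; case: c => a b; split.
- rewrite (_ : (fun t => _) =
    (fun t => a * complex.Re (f t) - b * complex.Im (f t))).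
    by apply: measurable_funB; exact: measurable_funM.
  by apply/funext => t; rewrite /= fctE; case: (f t).
- rewrite (_ : (fun t => _) =
    (fun t => a * complex.Im (f t) + b * complex.Re (f t))).
    by apply: measurable_funD; exact: measurable_funM.
  by apply/funext => t; rewrite /= fctE; case: (f t).
Qed.

Lemma powR_leD a b p : 0 <= a -> 0 <= b -> 0 <= p ->
  (a + b) `^ p <= 2 `^ p * (a `^ p + b `^ p).
Proof.
wlog ab : a b / a <= b => [H a0 b0 p0|a0 b0 p0].
  have [ab|/ltW ab] := leP a b; first exact: H.
  by rewrite addrC [X in _ * X]addrC; exact: H.
rewrite (@le_trans _ _ ((2 * b) `^ p))//.
  rewrite ge0_ler_powR ?nnegrE ?addr_ge0 ?mulr_ge0//.
  by rewrite mulr_natl mulr2n lerD2r.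
by rewrite powRM// ler_wpM2l ?powR_ge0// lerDr powR_ge0.
Qed.

Lemma powR_subadditive a b p : 0 <= a -> 0 <= b -> 0 < p <= 1 ->
  (a + b) `^ p <= a `^ p + b `^ p.
Proof.
move=> a0 b0 /andP[p0 p1].
have := addr_ge0 a0 b0; rewrite le_eqVlt => /predU1P[<-|ab0].
  by rewrite powR0 ?gt_eqF// addr_ge0// powR_ge0.
have H x : 0 <= x <= a + b -> x / (a + b) * (a + b) `^ p <= x `^ p.
  move=> /andP[]; rewrite le_eqVlt => /predU1P[<- _|x0 xab].
    by rewrite !mul0r powR_ge0.
  rewrite -[in leRHS](@divfK _ (a + b) _ x) ?gt_eqF// powRM ?divr_ge0 ?(ltW x0) ?(ltW ab0)//.
  rewrite ler_wpM2r ?powR_ge0// ger1_powR// divr_gt0//=.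
  by rewrite ler_pdivrMr// mul1r.
rewrite (le_trans _ (lerD (H a _) (H b _))) ?a0 ?b0 ?lerDl ?lerDr//.
by rewrite -mulrDl -mulrDl divff ?mul1r// gt_eqF.
Qed.


Variable p : R.
Hypothesis p0 : 0 < p.

Lemma measurable_log1pabs_powR f : complex_measurable_fun D f ->
  measurable_fun D (fun t => (log1pabs f t `^ p)%:E).
Proof.
move=> mf; apply/measurable_EFinP.
by apply: (@measurableT_comp _ _ _ _ _ _ (@powR R ^~ p)) => //;
  exact: measurable_log1pabs.
Qed.

Lemma log_integral_ge0 f : (0 <= log_integral mu D p f)%E.
Proof. by rewrite unlock; apply: integral_ge0 => t _; rewrite lee_fin powR_ge0. Qed.

Lemma eq_log_integral f g : complex_measurable_fun D f ->
    complex_measurable_fun D g -> f = g %[ae mu in D] ->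
  log_integral mu D p f = log_integral mu D p g.
Proof.
move=> mf mg fg; rewrite unlock; apply: ge0_ae_eq_integral => //.
- exact: measurable_log1pabs_powR.
- exact: measurable_log1pabs_powR.
- by move=> t _; rewrite lee_fin powR_ge0.
- by move=> t _; rewrite lee_fin powR_ge0.
- by apply: filterS fg => t fg Dt; rewrite /log1pabs fg.
Qed.

Lemma log_integral_eq0 f : complex_measurable_fun D f ->
  log_integral mu D p f = 0%E <-> f = 0 %[ae mu in D].
Proof.
move=> mf; have mF := measurable_log1pabs_powR mf.
have [H1 H2] := ae_eq_integral_abs mu mD mF.
split=> [f0|f0].
- move: f0; rewrite unlock => f0; have {H1 H2 f0} : ae_eq mu D (fun t => (log1pabs f t `^ p)%:E) (cst 0%E).
    apply: H1; rewrite -[RHS]f0; apply: eq_integral => t _.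
    by rewrite gee0_abs// lee_fin powR_ge0.
  by apply: filterS => t /[apply] -[] /powR_eq0_eq0/log1pabs_eq0.
- have m0 : complex_measurable_fun D (0 : T -> R[i]) by split.
  rewrite (eq_log_integral mf m0 f0) unlock.
  rewrite (eq_integral (cst 0%E)) ?integral0// => t _.
  by rewrite /log1pabs normc0 addr0 ln1 powR0// gt_eqF.
Qed.

Lemma log_integralN f : log_integral mu D p (- f) = log_integral mu D p f.
Proof. by rewrite unlock; apply: eq_integral => t _; rewrite log1pabsN. Qed.

Lemma LpfunP f : reflect
  (complex_measurable_fun D f /\ (log_integral mu D p f < +oo)%E)
  (f \in Lpfun mu D p).
Proof. by apply: (iffP idP); rewrite inE. Qed.

Lemma Lpfun_addr_closed : addr_closed (Lpfun mu D p).
Proof.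
split.
  apply/LpfunP; have m0 : complex_measurable_fun D (0 : T -> R[i]) by split.
  by split => //; rewrite (log_integral_eq0 m0).2 ?ltry//; exact: ae_eq_refl.
move=> f g /LpfunP[mf If] /LpfunP[mg Ig]; apply/LpfunP.
have mfg := complex_measurable_funD mf mg; split; first exact: mfg.
move: If Ig; rewrite unlock => If Ig.
apply: (@le_lt_trans _ _ (\int[mu]_(t in D)
    ((2 `^ p)%:E * ((log1pabs f t `^ p)%:E + (log1pabs g t `^ p)%:E)))%E).
  apply: ge0_le_integral => //.
  - by move=> t _; rewrite lee_fin powR_ge0.
  - exact: measurable_log1pabs_powR.
  - apply: measurable_funeM; apply: emeasurable_funD;
      exact: measurable_log1pabs_powR.
  - move=> t _; rewrite -EFinD -EFinM lee_fin.
    rewrite (le_trans _ (powR_leD _ _ (ltW p0))) ?log1pabs_ge0//.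
    by rewrite ge0_ler_powR ?nnegrE ?addr_ge0 ?log1pabs_ge0 ?(ltW p0)//
      log1pabsD.
rewrite ge0_integralZl_EFin ?powR_ge0//; last 2 first.
- by move=> t _; rewrite -EFinD lee_fin addr_ge0 ?powR_ge0.
- by apply: emeasurable_funD; exact: measurable_log1pabs_powR.
rewrite ge0_integralD//; last 4 first.
- by move=> t _; rewrite lee_fin powR_ge0.
- exact: measurable_log1pabs_powR.
- by move=> t _; rewrite lee_fin powR_ge0.
- exact: measurable_log1pabs_powR.
apply: lte_mul_pinfty; first by rewrite lee_fin powR_ge0.
  by [].
by apply: lte_add_pinfty; [exact: If|exact: Ig].
Qed.

Let Lpfun_mulrn f n : f \in Lpfun mu D p -> f *+ n \in Lpfun mu D p.
Proof.
have [L0 LD] := Lpfun_addr_closed.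
move=> Lf; elim: n => [|n IHn]; first exact: L0.
have := LD _ _ Lf IHn.
rewrite -mulrS.
exact.
Qed.

Lemma Lpfun_scaler_closed : scaler_closed (Lpfun mu D p).
Proof.
move=> c f Lf; have /LpfunP[mf If] := Lf; apply/LpfunP.
have mcf := complex_measurable_funZ c mf; split; first exact: mcf.
pose n := (Num.truncn (normc c)).+1.
have /LpfunP[mnf] : f *+ n \in Lpfun mu D p.
  exact: Lpfun_mulrn.
rewrite unlock; apply: le_lt_trans; apply: ge0_le_integral => //.
- by move=> t _; rewrite lee_fin powR_ge0.
- exact: measurable_log1pabs_powR.
- exact: measurable_log1pabs_powR.
move=> t _; rewrite lee_fin ge0_ler_powR ?nnegrE ?log1pabs_ge0 ?(ltW p0)//.
apply: ler_log1pabs; rewrite fctE normcM.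
have -> : (f *+ n) t = f t *+ n.
  elim: (n) => [|k IHk]; first by rewrite !mulr0n.
  by rewrite !mulrS -IHk.
rewrite normcMn -mulr_natl ler_wpM2r// /n.
by rewrite ltW// Num.Theory.truncnS_gt.
Qed.

Lemma Lpfun_submod_closed : submod_closed (Lpfun mu D p).
Proof.
have [L0 LD] := Lpfun_addr_closed; split; first exact: L0.
move=> c f g Lf Lg; exact: (LD _ _ (Lpfun_scaler_closed c Lf) Lg).
Qed.

Lemma lognormD f g : f \in Lpfun mu D p -> g \in Lpfun mu D p ->
  lognorm mu D p (f + g) `^ Num.min p 1 <=
  lognorm mu D p f `^ Num.min p 1 + lognorm mu D p g `^ Num.min p 1.
Proof.
move=> Lf Lg; have /LpfunP[mfg Ifg] := Lpfun_addr_closed.2 _ _ Lf Lg.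
move: Lf Lg => /LpfunP[mf If] /LpfunP[mg Ig].
have fin h : (log_integral mu D p h < +oo)%E ->
    log_integral mu D p h \is a fin_num.
  by move=> ?; rewrite ge0_fin_numE// log_integral_ge0.
have [p1|p1] := leP p 1.
  have lnE h : lognorm mu D p h `^ p = fine (log_integral mu D p h).
    rewrite -[LHS]powRrM mulVf; last exact: lt0r_neq0.
    by apply: powRr1; exact: fine_ge0 (log_integral_ge0 _).
  rewrite !lnE.
  rewrite -fineD; [|exact: fin|exact: fin].
  apply: fine_le; [exact: fin| by rewrite fin_numD !fin | ].
  rewrite unlock -ge0_integralD//; last 4 first.
  - by move=> t _; rewrite lee_fin powR_ge0.
  - exact: measurable_log1pabs_powR.
  - by move=> t _; rewrite lee_fin powR_ge0.
  - exact: measurable_log1pabs_powR.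
  apply: ge0_le_integral => //.
  - by move=> t _; rewrite lee_fin powR_ge0.
  - exact: measurable_log1pabs_powR.
  - by apply: emeasurable_funD; exact: measurable_log1pabs_powR.
  - move=> t _; rewrite -EFinD lee_fin.
    rewrite (le_trans _ (powR_subadditive _ _ _)) ?log1pabs_ge0 ?p0//.
    by rewrite ge0_ler_powR ?nnegrE ?addr_ge0 ?log1pabs_ge0 ?(ltW p0)//
      log1pabsD.
rewrite !powRr1 ?powR_ge0//.
pose u h : T -> R := log1pabs h \_ D.
have mu_ h : complex_measurable_fun D h -> measurable_fun setT (u h).
  move=> mh; apply/(measurable_restrictT (log1pabs h) mD).
  exact: measurable_log1pabs.
have LnE h : (log_integral mu D p h < +oo)%E ->
    (lognorm mu D p h)%:E = 'N[mu]_p%:E[EFin \o u h]%E.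
  move=> Ih; rewrite /lognorm -poweR_EFin fineK ?fin// !unlock.
  congr (_ `^ _)%E; rewrite integral_mkcond.
  apply: eq_integral => t _; rewrite /u /patch /=; case: ifP => _.
    by rewrite ger0_norm ?log1pabs_ge0.
  by rewrite normr0 powR0// gt_eqF.
rewrite -lee_fin EFinD !LnE//.
apply: (@le_trans _ _ ('N[mu]_p%:E[EFin \o (u f \+ u g)%R])%E); last first.
  by apply: minkowski_EFin; rewrite ?ltW//; exact: mu_.
rewrite unlock; apply: gt0_ler_poweR; rewrite ?invr_ge0 ?(ltW p0)//.
- by rewrite in_itv/= leey andbT integral_ge0// => t _; rewrite poweR_ge0.
- by rewrite in_itv/= leey andbT integral_ge0// => t _; rewrite poweR_ge0.
have mp (v : T -> R) : measurable_fun setT v ->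
    measurable_fun setT (fun t => (`|(v t)%:E| `^ p)%E).
  move=> mv; apply: (@measurableT_comp _ _ _ _ _ _ (@poweR R ^~ p)).
    exact: measurable_poweR.
  by apply: measurableT_comp => //; exact/measurable_EFinP.
apply: ge0_le_integral => //.
- by move=> t _; exact: poweR_ge0.
- by apply: mp; exact: mu_.
- by apply: mp; apply: measurable_funD; exact: mu_.
move=> t _; rewrite /= lee_fin ge0_ler_powR ?nnegrE ?(ltW p0)//.
rewrite /u /patch; case: ifP => _; last by rewrite addr0.
by rewrite !ger0_norm ?addr_ge0 ?log1pabs_ge0// log1pabsD.
Qed.

End log_integral_lemmas.

Section Lplus.
Context d (T : measurableType d) (R : realType).
Variables (mu : {measure set T -> \bar R}) (D : set T) (mD : measurable D).
Variables (p : R) (p0 : 0 < p).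

(* mD and p0 do not occur in the body: they are parameters of the type, as in
   LfunType, because its vector space structure depends on them. *)
Definition LpfunType (mD : measurable D) (p0 : 0 < p) : Type :=
  {f | f \in Lpfun mu D p}.
Local Notation Lfun := (LpfunType mD p0).

#[local] HB.instance Definition _ := GRing.isSubmodClosed.Build R[i] (T -> R[i])
  (Lpfun mu D p) (Lpfun_submod_closed mu mD p0).
HB.instance Definition _ := SubChoice.on Lfun.
HB.instance Definition _ := [SubChoice_isSubLmodule of Lfun by <:].

Lemma LpfunType_measurable (f : Lfun) : complex_measurable_fun D (val f).
Proof. by have /LpfunP[] := valP f. Qed.

Lemma LpfunType_lty (f : Lfun) : (log_integral mu D p (val f) < +oo)%E.
Proof. by have /LpfunP[] := valP f. Qed.

Definition Lnull : {pred Lfun} := mem [set f | val f = 0 %[ae mu in D]].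

Lemma LnullP (f : Lfun) : reflect (val f = 0 %[ae mu in D]) (f \in Lnull).
Proof. by apply: (iffP idP); rewrite inE. Qed.

Lemma Lnull_scale (c : R[i]) (f : Lfun) : f \in Lnull -> c *: f \in Lnull.
Proof.
move=> /LnullP f0; apply/LnullP; apply: filterS f0 => t + Dt => /(_ Dt) ft.
by rewrite linearZ/= fctE ft scaler0.
Qed.

Lemma Lnull_zmod_closed : zmod_closed Lnull.
Proof.
split; first by apply/LnullP; exact: aeW.
move=> f g /LnullP f0 /LnullP g0; apply/LnullP; apply: filterS2 f0 g0.
move=> t + + Dt => /(_ Dt) ft /(_ Dt) gt.
by rewrite raddfB/= !fctE ft gt subr0.
Qed.

HB.instance Definition _ := GRing.isZmodClosed.Build Lfun Lnull
  Lnull_zmod_closed.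

(* a.e.-equivalence classes: the quotient identifies f and g when f - g
   vanishes a.e. on D, see Lplus_eqP. *)
Definition Lplus : Type := Quotient.quot Lnull.

HB.instance Definition _ := Choice.on Lplus.
HB.instance Definition _ := EqQuotient.on Lplus.
HB.instance Definition _ := GRing.Zmodule.on Lplus.
HB.instance Definition _ := ZmodQuotient.on Lplus.

Lemma Lplus_eqP (f g : Lfun) :
  reflect (val f = val g %[ae mu in D]) (\pi_Lplus f == \pi_Lplus g).
Proof.
rewrite -Quotient.idealrBE.
apply: (iffP (LnullP _)); apply: filterS => t fg Dt; have := fg Dt.
- by rewrite raddfB/= !fctE => /eqP; rewrite subr_eq0 => /eqP.
- by rewrite raddfB/= !fctE => ->; rewrite subrr.
Qed.

Definition Lplus_scale (c : R[i]) (x : Lplus) : Lplus :=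
  \pi_Lplus (c *: repr x).

Lemma pi_Lplus_scale c (f : Lfun) :
  Lplus_scale c (\pi_Lplus f) = \pi_Lplus (c *: f).
Proof.
apply/eqP; rewrite -Quotient.idealrBE -scalerBr; apply: Lnull_scale.
by rewrite Quotient.idealrBE reprK.
Qed.

Let Lplus_ind (P : Lplus -> Prop) : (forall f, P (\pi_Lplus f)) ->
  forall x, P x.
Proof. by move=> H x; rewrite -[x]reprK; exact: H. Qed.

Let scaleA a b (x : Lplus) :
  Lplus_scale a (Lplus_scale b x) = Lplus_scale (a * b) x.
Proof. by elim/Lplus_ind: x => f; rewrite !pi_Lplus_scale scalerA. Qed.

Let scale1 : left_id 1 Lplus_scale.
Proof. by elim/Lplus_ind => f; rewrite !pi_Lplus_scale scale1r. Qed.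

Let scaleDr : right_distributive Lplus_scale +%R.
Proof.
move=> a; elim/Lplus_ind => f; elim/Lplus_ind => g.
by rewrite !pi_Lplus_scale -!raddfD/= !pi_Lplus_scale scalerDr raddfD.
Qed.

Let scaleDl (x : Lplus) : {morph Lplus_scale^~ x : a b / a + b}.
Proof.
move=> a b; elim/Lplus_ind: x => f.
by rewrite !pi_Lplus_scale scalerDl raddfD.
Qed.

HB.instance Definition _ := GRing.Zmodule_isLmodule.Build R[i] Lplus
  scaleA scale1 scaleDr scaleDl.

(* Independent of the representative by Lplus_normE; likewise the scaling above
   by pi_Lplus_scale. *)
Definition Lplus_norm (x : Lplus) : R := lognorm mu D p (val (repr x)).

Lemma Lplus_normE (f : Lfun) :
  Lplus_norm (\pi_Lplus f) = lognorm mu D p (val f).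
Proof.
rewrite /Lplus_norm /lognorm; congr (fine _ `^ _).
apply: eq_log_integral => //; try exact: LpfunType_measurable.
by apply/Lplus_eqP; rewrite reprK.
Qed.

Definition Lplus_dist (x y : Lplus) : R := Lplus_norm (x - y) `^ Num.min p 1.

Let minp1_neq0 : Num.min p 1 != 0.
Proof. by rewrite gt_eqF// lt_min p0/=. Qed.

Let Lplus_norm_eq0 x : Lplus_norm x = 0 -> x = 0.
Proof.
elim/Lplus_ind: x => f; rewrite Lplus_normE => /powR_eq0_eq0 /eqP.
rewrite fine_eq0 ?ge0_fin_numE ?log_integral_ge0 ?LpfunType_lty// => /eqP.
move/(log_integral_eq0 mu mD p0 (LpfunType_measurable f)) => f0.
rewrite -[RHS](raddf0 \pi_Lplus); apply/eqP/Lplus_eqP; exact: f0.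
Qed.

Let Lplus_norm0 : Lplus_norm 0 = 0.
Proof.
rewrite -[0 in LHS](raddf0 \pi_Lplus) Lplus_normE /lognorm.
have [_ ->] := log_integral_eq0 mu mD p0 (LpfunType_measurable 0).
  by rewrite powR0// invr_eq0 gt_eqF.
exact: aeW.
Qed.

Let Lplus_normN x : Lplus_norm (- x) = Lplus_norm x.
Proof.
elim/Lplus_ind: x => f; rewrite -raddfN !Lplus_normE /lognorm.
by rewrite raddfN log_integralN.
Qed.

Let dist_xx x : Lplus_dist x x = 0.
Proof. by rewrite /Lplus_dist subrr Lplus_norm0 powR0. Qed.

Let dist_eq0 x y : Lplus_dist x y = 0 -> x = y.
Proof. by move=> /powR_eq0_eq0/Lplus_norm_eq0/eqP; rewrite subr_eq0 => /eqP. Qed.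

Let dist_sym x y : Lplus_dist x y = Lplus_dist y x.
Proof. by rewrite /Lplus_dist -opprB Lplus_normN. Qed.

Let dist_triangle y x z : Lplus_dist x z <= Lplus_dist x y + Lplus_dist y z.
Proof.
rewrite /Lplus_dist -(subrKA y x (- z)); move: (x - y) (y - z).
elim/Lplus_ind => f; elim/Lplus_ind => g.
rewrite -raddfD !Lplus_normE raddfD; apply: lognormD => //; exact: valP.
Qed.

HB.instance Definition _ := isMetric.Build R Lplus
  dist_xx dist_eq0 dist_sym dist_triangle.

End Lplus.

Definition lebesgue_display (R : realType) : measure_display :=
  caratheodory_display (wlength (@idfun R))^*%mu.

(* The real line with its Lebesgue (rather than Borel) measurable sets. *)
Definition lebesgueR (R : realType) : measurableType (lebesgue_display R) :=
  caratheodory_type (wlength (@idfun R))^*%mu.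

Lemma invr_2pi_ge0 (R : realType) : 0 <= (2 * pi)^-1 :> R.
Proof. by rewrite invr_ge0 mulr_ge0// pi_ge0. Qed.

Definition dt_2pi (R : realType) : {measure set (lebesgueR R) -> \bar R} :=
  mscale (NngNum (invr_2pi_ge0 R)) (@completed_lebesgue_measure R).

Definition itv_0_2pi (R : realType) : set (lebesgueR R) := `[(0 : R), 2 * pi[.

Arguments dt_2pi : clear implicits.
Arguments itv_0_2pi : clear implicits.

Lemma measurable_itv_0_2pi (R : realType) : measurable (itv_0_2pi R).
Proof. by apply: sub_caratheodory; exact: measurable_itv. Qed.
Arguments measurable_itv_0_2pi : clear implicits.

(* Main.v *)
(* Cut f into the n pieces f 1_{A_i} with |A_i| <= 1/n. Then f is the average of
   the n functions n f 1_{A_i}, and since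
   log (1 + n |f|) <= log (1 + n) + log (1 + |f|), the integral of
   log (1 + n |f|)^p over A_i is at most a constant times
   log (1 + n)^p / n plus the integral of log (1 + |f|)^p over A_i; both terms
   tend to 0 uniformly in i. So every f is an average of vectors that are
   arbitrarily close to 0: a continuous linear functional is then bounded by 1
   on the whole space, hence zero. *)
Require Import Defs.
From HB Require Import structures.
From mathcomp Require Import all_boot all_order all_algebra complex.
From mathcomp Require Import all_classical all_reals all_analysis.
From mathcomp Require Import lra measurable_realfun.

Set Implicit Arguments.
Unset Strict Implicit.
Unset Printing Implicit Defensive.

Import Order.TTheory GRing.Theory Num.Theory.
Import numFieldNormedType.Exports.
Local Open Scope classical_set_scope.
Local Open Scope ring_scope.

(** * Growth of powers of the logarithm *)

Lemma ln_powR_le_sqrt {R : realType} (p x : R) : 0 < p -> 0 <= x ->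
  ln (1 + x) `^ p <= (2 * p) `^ p * Num.sqrt (1 + x).
Proof.
move=> p0 x0; have x10 : 0 < 1 + x by rewrite ltr_pwDl.
have q0 : 0 < 2 * p by rewrite mulr_gt0.
have l0 : 0 <= ln (1 + x) by rewrite ln_ge0// lerDl.
rewrite -powR12_sqrt ?(ltW x10)//.
(* The square root is the [p]-th power of y = (1 + x)^(1/(2p)), so after removing the power [p] only
   ln y <= y remains. *)
have -> : 2^-1 = (2 * p)^-1 * p :> R.
  by rewrite invfM -mulrA mulVf ?mulr1 ?gt_eqF.
rewrite powRrM -powRM ?powR_ge0 ?(ltW q0)//.
rewrite ge0_ler_powR ?nnegrE ?mulr_ge0 ?powR_ge0 ?(ltW q0) ?(ltW p0)//.
rewrite -ler_pdivrMl// -ln_powR.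
apply: ltW; apply: ln_sublinear; exact: powR_gt0.
Qed.

Lemma ln_powR_near_infty {R : realType} (p e : R) : 0 < p -> 0 < e ->
  \forall n \near \oo, ln (1 + n.+1%:R) `^ p / n.+1%:R < e.
Proof.
move=> p0 e0; near=> n.
have m1 : 1 <= n.+1%:R :> R by rewrite ler1n.
have m0 : 0 < n.+1%:R :> R by rewrite ltr0n.
rewrite ltr_pdivrMr// (le_lt_trans (ln_powR_le_sqrt p0 (ltW m0)))//.
set K := (2 * p) `^ p; have K0 : 0 <= K by exact: powR_ge0.
rewrite -(@ltr_pXn2r _ 2)// ?nnegrE ?mulr_ge0 ?sqrtr_ge0 ?(ltW e0)//.
rewrite !exprMn sqr_sqrtr ?addr_ge0//.
(* With m = n + 1, squaring K sqrt(1 + m) < e m and using 1 + m <= 2 m leaves 2 K^2 < e^2 m. *)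
have : K ^+ 2 * 2 / e ^+ 2 < n.+1%:R.
  rewrite (@lt_trans _ _ n%:R) ?ltr_nat//.
  by near: n; exact: nbhs_infty_gtr.
rewrite ltr_pdivrMr ?exprn_gt0// => Kn.
apply: (@le_lt_trans _ _ (K ^+ 2 * (2 * n.+1%:R))).
  by rewrite ler_wpM2l ?sqr_ge0// [leRHS]mulrDl mul1r lerD2r.
by rewrite mulrA expr2 [ltRHS]mulrA ltr_pM2r// [ltRHS]mulrC.
Unshelve. all: by end_near. Qed.

(** Turns smallness of the integral [z] into smallness of the distance to 0, which is (z^(1/p))^m
    for m = min(p, 1). *)
Lemma powR_root_lt {R : realType} (p m e z : R) : 0 < p -> 0 < m -> 0 < e ->
  0 <= z -> z < (e `^ m^-1) `^ p -> (z `^ p^-1) `^ m < e.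
Proof.
move=> p0 m0 e0 z0 ze.
rewrite [ltRHS](_ : e = (((e `^ m^-1) `^ p) `^ p^-1) `^ m); last first.
  by rewrite -!powRrM mulVKf ?mulVf ?gt_eqF// powRr1 ?ltW.
have nneg (x q : R) : x `^ q \in Num.nneg by rewrite nnegrE; exact: powR_ge0.
have z1 : z `^ p^-1 < ((e `^ m^-1) `^ p) `^ p^-1.
  by apply: (gt0_ltr_powR _ _ (nneg _ _) ze); [rewrite invr_gt0|rewrite nnegrE].
exact: (gt0_ltr_powR m0 (nneg _ _) (nneg _ _) z1).
Qed.

(** * Restricting a function to a measurable piece *)

Section log_integral_cut.
Context d (T : measurableType d) (R : realType).
Context (mu : {measure set T -> \bar R}) (D : set T) (mD : measurable D).
Implicit Types (f : T -> R[i]) (A : set T) (c : R[i]).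

Definition cut A f : T -> R[i] := patch (fun=> 0) A f.

Lemma cutZ c A f : cut A (c *: f) = c *: cut A f.
Proof.
apply/funext => t; rewrite /cut /patch /= !fctE.
by case: ifP => // _; rewrite scaler0.
Qed.

Lemma complex_measurable_fun_cut A f : measurable A ->
  complex_measurable_fun D f -> complex_measurable_fun D (cut A f).
Proof.
move=> mA [mr mi].
have H (phi : R[i] -> R) : phi 0 = 0 -> measurable_fun D (phi \o f) ->
    measurable_fun D (fun t => phi (cut A f t)).
  move=> phi0 mphi.
  have -> : (fun t => phi (cut A f t)) = (phi \o f) \_ A.
    by apply/funext => t; rewrite /cut /patch/=; case: ifP.
  apply/measurable_restrict => //.
  by apply: measurable_funS mphi => //; exact: subIsetl.
by split; [exact: (H (@complex.Re R)) | exact: (H (@complex.Im R))].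
Qed.

Context (p : R) (p0 : 0 < p).

Lemma log_integral_cut A f : log_integral mu D p (cut A f) =
  (\int[mu]_(t in D `&` A) (log1pabs f t `^ p)%:E)%E.
Proof.
rewrite unlock integral_mkcondr; apply: eq_integral => t _.
rewrite /log1pabs /cut /patch; case: ifP => // _.
by rewrite Normc.normc0 addr0 ln1 powR0// gt_eqF.
Qed.

(** Since 1 + |c| |f| <= (1 + |c|) (1 + |f|), the logarithm splits into a constant plus log (1 +
    |f|); [powR_leD] separates their [p]-th powers at the cost of the factor 2^p. *)
Lemma log_integral_cut_scale_le A f c : measurable A ->
  complex_measurable_fun D f ->
  (log_integral mu D p (c *: cut A f) <=
   (2 `^ p)%:E * ((ln (1 + Normc.normc c) `^ p)%:E * mu (D `&` A) +
                  log_integral mu D p (cut A f)))%E.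
Proof.
move=> mA mf; have mDA : measurable (D `&` A) by exact: measurableI.
have normc_ge0 (z : R[i]) : 0 <= Normc.normc z.
  by case: z => a b; exact: sqrtr_ge0.
have mlog g : complex_measurable_fun D g ->
    measurable_fun (D `&` A) (fun t => (log1pabs g t `^ p)%:E).
  move=> mg; apply: measurable_funS (measurable_log1pabs_powR p mg) => //.
have lnc0 : 0 <= ln (1 + Normc.normc c) by rewrite ln_ge0// lerDl.
rewrite -cutZ !log_integral_cut.
have -> : ((ln (1 + Normc.normc c) `^ p)%:E * mu (D `&` A) =
    \int[mu]_(t in D `&` A) (ln (1 + Normc.normc c) `^ p)%:E)%E.
  by rewrite integral_cst.
rewrite -ge0_integralD//; last 3 first.
- by move=> t _; rewrite lee_fin powR_ge0.
- by move=> t _; rewrite lee_fin powR_ge0.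
- exact: mlog.
rewrite -ge0_integralZl_EFin ?powR_ge0//; last 2 first.
- by move=> t _; rewrite -EFinD lee_fin addr_ge0 ?powR_ge0.
- by apply: emeasurable_funD => //; exact: mlog.
apply: ge0_le_integral => //.
- by move=> t _; rewrite lee_fin powR_ge0.
- by apply: mlog; exact: complex_measurable_funZ.
- apply: measurable_funeM; apply: emeasurable_funD => //; exact: mlog.
move=> t _; rewrite -EFinD -EFinM lee_fin.
rewrite (le_trans _ (powR_leD lnc0 (log1pabs_ge0 f t) (ltW p0)))//.
rewrite ge0_ler_powR ?nnegrE ?addr_ge0 ?log1pabs_ge0 ?(ltW p0)//.
have H (z : R[i]) : 0 < 1 + Normc.normc z by rewrite ltr_pwDl.
rewrite /log1pabs -lnM ?posrE// ler_ln ?posrE ?mulr_gt0// fctE Normc.normcM.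
have := normc_ge0 c; have := normc_ge0 (f t); lra.
Qed.

End log_integral_cut.

(** A quantitative form of nonatomicity, and the only property of dt/2pi on [0, 2pi) that the
    argument uses. The pieces may stick out of [D]. *)
Definition divisible d (T : measurableType d) (R : realType)
    (mu : {measure set T -> \bar R}) (D : set T) :=
  forall n, exists A : 'I_n.+1 -> set T,
    [/\ forall i, measurable (A i), trivIset setT A, D `<=` \bigcup_i A i &
        forall i, (mu (A i) <= n.+1%:R^-1%:E)%E].

(** * Vectors as averages of vectors near 0 *)

Section averages.
Context d (T : measurableType d) (R : realType).
Context (mu : {measure set T -> \bar R}) (D : set T) (mD : measurable D).
Context (p : R) (p0 : 0 < p).
Local Notation L := (Lplus mu mD p0).
Local Notation Lfun := (LpfunType mu mD p0).
Local Open Scope quotient_scope.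

Lemma cut_subproof (A : set T) (mA : measurable A) (f : Lfun) :
  cut A (val f) \in Lpfun mu D p.
Proof.
apply/LpfunP; split.
  by apply: complex_measurable_fun_cut => //; exact: LpfunType_measurable.
apply: le_lt_trans (LpfunType_lty f).
rewrite log_integral_cut// unlock; apply: ge0_subset_integral => //.
- exact: measurableI.
- by apply: measurable_log1pabs_powR; exact: LpfunType_measurable.
- by move=> t _; rewrite lee_fin powR_ge0.
Qed.

Definition Lcut (A : set T) (mA : measurable A) (f : Lfun) : Lfun :=
  exist _ (cut A (val f)) (cut_subproof mA f).

Lemma sum_Lcut n (A : 'I_n -> set T) (mA : forall i, measurable (A i))
    (f : Lfun) : trivIset setT A -> D `<=` \bigcup_i A i ->
  \pi_L f = \sum_i \pi_L (Lcut (mA i) f).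
Proof.
move=> tA DA; rewrite -raddf_sum; apply/eqP/Lplus_eqP/aeW => t Dt.
have [j _ Ajt] := DA t Dt.
rewrite raddf_sum fct_sumE (bigD1 j)//= big1 ?addr0; last first.
  move=> i ij; rewrite /cut /patch ifF//; apply/negbTE/negP; rewrite inE => Ait.
  by move/eqP: ij; apply; apply: (tA i j) => //; exists t.
by rewrite /cut /patch mem_set.
Qed.

(** Absolute continuity of the integral of log (1 + |f|)^p, extended by 0 outside [D]. The threshold
    [r] depends on the measure of the piece alone, hence serves all pieces at once. *)
Lemma log_integral_cut_near0 (f : Lfun) (e : R) : 0 < e ->
  exists2 r : R, 0 < r & forall A, measurable A -> (mu A < r%:E)%E ->
    (log_integral mu D p (cut A (val f)) < e%:E)%E.
Proof.
move=> e0; pose g := (fun t => log1pabs (val f) t `^ p) \_ D.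
have g0 t : 0 <= g t.
  by rewrite /g /patch; case: ifP => // _; exact: powR_ge0.
have mf := LpfunType_measurable f.
have EgE : EFin \o g = (fun t => (log1pabs (val f) t `^ p)%:E) \_ D.
  by apply/funext => t; rewrite /g /patch/=; case: ifP.
have ig : mu.-integrable setT (EFin \o g).
  apply/integrableP; split.
    rewrite EgE; apply/(measurable_restrictT _ mD).
    exact: measurable_log1pabs_powR.
  rewrite (eq_integral (EFin \o g)) => [|t _]; last first.
    by rewrite gee0_abs ?lee_fin.
  by rewrite EgE -integral_mkcond; have := LpfunType_lty f; rewrite unlock.
have [r [r0 H]] := integral_normr_continuous ig e0.
exists r => // A mA /(H _ mA); rewrite -lte_fin; apply: le_lt_trans.
have iA : mu.-integrable A (EFin \o g) by exact: integrableS ig.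
rewrite log_integral_cut// setIC integral_mkcondr -EgE /Rintegral fineK.
  by under [leRHS]eq_integral do rewrite ger0_norm//.
apply: integrable_fin_num => //.
exact: (integrable_norm iA).
Qed.

Lemma ball0_Lplus (f : Lfun) (e : R) : 0 < e ->
  (log_integral mu D p (val f) < ((e `^ (Num.min p 1)^-1) `^ p)%:E)%E ->
  ball (0 : L) e (\pi_L f).
Proof.
move=> e0 fe; apply: ball_sym; rewrite ballEmdist.
have m0 : 0 < Num.min p 1 by rewrite lt_min p0/=.
change (Lplus_dist (\pi_L f) 0 < e).
rewrite /Lplus_dist subr0 Lplus_normE /lognorm.
have I0 : (0 <= log_integral mu D p (val f))%E by exact: log_integral_ge0.
have If : log_integral mu D p (val f) \is a fin_num.
  by rewrite ge0_fin_numE// LpfunType_lty.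
move: fe I0; rewrite -(fineK If) lte_fin lee_fin => fe I0; exact: powR_root_lt.
Qed.

Lemma small_average : divisible mu D -> forall (x : L) (e : R), 0 < e ->
  exists n (y : 'I_n.+1 -> L),
    x = n.+1%:R^-1 *: \sum_i y i /\ forall i, ball (0 : L) e (y i).
Proof.
move=> divD x e e0; rewrite -[x]reprK; set f := repr x.
set eta := (e `^ (Num.min p 1)^-1) `^ p.
have eta0 : 0 < eta by rewrite !powR_gt0.
have twop : 0 < 2 `^ p :> R by rewrite powR_gt0.
(* Each of the two terms in [log_integral_cut_scale_le] may take half of eta / 2^p, as their sum
   gets multiplied by 2^p. *)
have eta20 : 0 < eta / 2 `^ p / 2 by rewrite !divr_gt0.
have [r r0 Hr] := log_integral_cut_near0 f eta20.
have [n [nr nln]] : exists n, n.+1%:R^-1 < r /\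
    ln (1 + n.+1%:R) `^ p / n.+1%:R < eta / 2 `^ p / 2.
  near \oo => n; exists n; split; near: n.
    exact: (near_infty_natSinv_lt (PosNum r0)).
  exact: ln_powR_near_infty.
have [A [mA tA DA muA]] := divD n.
exists n, (fun i => \pi_L (n.+1%:R *: Lcut (mA i) f)); split.
  rewrite (sum_Lcut mA f tA DA) scaler_sumr; apply: eq_bigr => i _.
  rewrite -pi_Lplus_scale.
  change (\pi_L (Lcut (mA i) f) =
    n.+1%:R^-1 *: (n.+1%:R *: \pi_L (Lcut (mA i) f))).
  by rewrite scalerA mulVf ?scale1r// pnatr_eq0.
move=> i; apply: ball0_Lplus => //.
rewrite linearZ/=.
have mf := LpfunType_measurable f.
apply: (le_lt_trans (log_integral_cut_scale_le mu mD p0 n.+1%:R (mA i) mf)).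
rewrite normcMn Normc.normc1 -/eta.
have -> : eta = 2 `^ p * (eta / 2 `^ p / 2 + eta / 2 `^ p / 2).
  by rewrite -splitr mulrCA divff ?mulr1// gt_eqF.
rewrite EFinM lte_pmul2l// EFinD; apply: lteD.
  apply: (@le_lt_trans _ _ ((ln (1 + n.+1%:R) `^ p)%:E * n.+1%:R^-1%:E)%E).
    apply: lee_pmul => //; first by rewrite lee_fin powR_ge0.
    apply: le_trans (muA i); apply: le_measure; rewrite ?inE//.
      exact: measurableI.
  by rewrite -EFinM lte_fin.
by apply: Hr => //; apply: le_lt_trans (muA i) _; rewrite lte_fin.
Unshelve. all: by end_near. Qed.

Lemma continuous_linear_eq0 (F : {linear L -> R[i]^o}) : divisible mu D ->
  continuous F -> forall x, F x = 0.
Proof.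
move=> divD cF.
have [e /= e0 He] : exists2 e : R, 0 < e &
    forall y, ball (0 : L) e y -> `|F y| < 1.
  have : \forall y \near (0 : L), `|F 0 - F y| < 1.
    by have /cvgrPdist_lt := cF 0; apply; exact: ltr01.
  move=> /nbhs_ballP[e /= e0 He]; exists e => // y /He /=.
  by rewrite linear0 sub0r normrN.
have F1 y : `|F y| < 1.
  have [n [z [-> zball]]] := small_average divD y e0.
  rewrite linearZ/= linear_sum normrM normfV normr_nat.
  rewrite ltr_pdivrMl ?ltr0n// mulr1.
  apply: (le_lt_trans (ler_norm_sum _ _ _)).
  have -> : n.+1%:R = \sum_(i < n.+1) 1 :> R[i] by rewrite sumr_const card_ord.
  (* Strict bounds add up to a strict bound because the sum has n + 1 > 0 terms. *)
  apply: ltr_sum => [|i _]; last by apply: He; exact: zball.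
  by apply/hasP; exists ord0; rewrite ?mem_index_enum.
move=> x; apply/eqP/negPn/negP => Fx0.
(* The vector x / F x would have value exactly 1. *)
have := F1 ((F x)^-1 *: x).
by rewrite linearZ/= [X in `|X|]mulVf// normr1 ltxx.
Qed.

End averages.

(** * Equal subdivision of [0, 2pi) *)

Lemma divisible_itv_0_2pi (R : realType) : divisible (dt_2pi R) (itv_0_2pi R).
Proof.
move=> n; pose h : R := 2 * pi / n.+1%:R.
have h0 : 0 < h by rewrite divr_gt0 ?mulr_gt0 ?pi_gt0 ?ltr0n.
pose B (i : 'I_n.+1) : set (lebesgueR R) := `[i%:R * h, i.+1%:R * h[%classic.
have BP (i : 'I_n.+1) (t : R) : B i t = (i%:R * h <= t < i.+1%:R * h) :> Prop.
  change ((t \in `[i%:R * h, i.+1%:R * h[) =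
    (i%:R * h <= t < i.+1%:R * h) :> Prop).
  by rewrite in_itv.
exists B; split.
- by move=> i; apply: sub_caratheodory; exact: measurable_itv.
(* A common point forces i < j + 1 and j < i + 1, so i = j. *)
- move=> i j _ _ [t []]; rewrite !BP => /andP[it ti] /andP[jt tj].
  have := le_lt_trans it tj; have := le_lt_trans jt ti.
  rewrite !ltr_pM2r// !ltr_nat !ltnS => ji ij.
  by apply/ord_inj/eqP; rewrite eqn_leq ij.
- move=> t; change (t \in `[(0 : R), 2 * pi[ -> (\bigcup_i B i) t).
  rewrite in_itv/= => /andP[t0 t2pi].
  have th0 : 0 <= t / h by rewrite divr_ge0// ltW.
  have /andP[lo hi] := truncn_itv th0.
  (* The piece containing [t] has index floor(t / h), which is a legal index because t < 2pi = (n +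
     1) h. *)
  have kn : (Num.truncn (t / h) < n.+1)%N.
    rewrite truncn_lt_nat// ltr_pdivrMr// /h mulrC divfK// pnatr_eq0.
  exists (Ordinal kn) => //; rewrite BP/=.
  by rewrite -ler_pdivlMr// lo/= -ltr_pdivrMr.
move=> i.
(* completed_lebesgue_measure and lebesgue_measure are convertible set
   functions, on different sigma-algebras. *)
have muB : completed_lebesgue_measure (B i) = h%:E.
  have := lebesgue_measure_itv `[(i%:R * h), i.+1%:R * h[.
  rewrite /= lte_fin ltr_pM2r// ltr_nat ltnSn -EFinB -mulrBl -natrB//.
  by rewrite subSnn mul1r.
change (((2 * pi)^-1%:E * completed_lebesgue_measure (B i) <= n.+1%:R^-1%:E)%E).
rewrite muB -EFinM lee_fin /h mulrA mulVf ?mul1r//.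
by rewrite gt_eqF ?mulr_gt0 ?pi_gt0.
Qed.

Theorem corollary4p2 (R : realType) (p : R) (p0 : 0 < p) :
  ~ exists F : {linear Lplus (dt_2pi R) (measurable_itv_0_2pi R) p0 -> R[i]^o},
      continuous F /\ exists f, F f != 0.
Proof.
move=> [F [cF [f]]]; rewrite (continuous_linear_eq0 _ cF) ?eqxx//.
exact: divisible_itv_0_2pi.
Qed.
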